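(* Let $a\geqslant 1$ be an integer and let $\beta>1$ satisfy $\beta^2=a\beta+1$. Every alphabet of contiguous integers containing $0$ with exactly $a+2$ elements allows parallel addition in base $\beta$, and no alphabet of contiguous integers containing $0$ and at least one other element, with fewer than $a+2$ elements, allows parallel addition in base $\beta$.
   Context: For a complex number $\beta$ with $|\beta|>1$ and a finite set $\mathcal{A}\subset\mathbb{C}$ containing $0$, let $\mathrm{Fin}_{\mathcal{A}}(\beta)=\{\sum_{j\in I}x_j\beta^j : I\subset\mathbb{Z}\text{ finite},\ x_j\in\mathcal{A}\}$. For finite alphabets $\mathcal{A},\mathcal{B}$, a map $\varphi:\mathcal{A}^{\mathbb{Z}}\to\mathcal{B}^{\mathbb{Z}}$ is $p$-local if there are integers $r,t\geqslant 0$ with $p=r+t+1$ and a map $\Phi:\mathcal{A}^p\to\mathcal{B}$ such that for every $u=(u_j)$ and $v=\varphi(u)$ one has $v_j=\Phi(u_{j+t}\cdots u_j\cdots u_{j-r})$ for all $j\in\mathbb{Z}$. A digit set conversion in base $\beta$ from $\mathcal{A}$ to $\mathcal{B}$ (both containing $0$) is a map $\varphi:\mathcal{A}^{\mathbb{Z}}\to\mathcal{B}^{\mathbb{Z}}$ such that whenever $u$ has finitely many nonzero entries, $v=\varphi(u)$ has finitely many nonzero entries and $\sum_j v_j\beta^j=\sum_j u_j\beta^j$. An alphabet $\mathcal{A}$ allows parallel addition in base $\beta$ if there is a digit set conversion in base $\beta$ from $\mathcal{A}+\mathcal{A}=\{x+y:x,y\in\mathcal{A}\}$ to $\mathcal{A}$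 that is $p$-local for some $p$. *)

(* Defs.v *)
From HB Require Import structures.
From mathcomp Require Import all_boot all_order all_algebra.
From mathcomp Require Import finmap.
From mathcomp Require Import boolp classical_sets functions cardinality fsbigop.
From mathcomp Require Import reals complex.
Set Implicit Arguments.
Unset Strict Implicit.
Unset Printing Implicit Defensive.
Import Order.TTheory GRing.Theory Num.Theory.
Local Open Scope ring_scope.

(* [A : {fset K}] is used as a type, so a word over the alphabet [A] is a
   function [int -> A] and [val (u j)] is its [j]-th digit. *)

Definition sumset (K : nzRingType) (A : {fset K}) : {fset K} :=
  [fset (x + y)%R | x in A, y in A]%fset.

Definition contiguous_integers (K : nzRingType) (A : {fset K}) : Prop :=
  exists m n : int, forall x : K,
    x \in A <-> exists2 k : int, m <= k <= n & x = k%:~R.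

(* The window [u_(j+t) ... u_j ... u_(j-r)] is read from left to right:
   position [i < p] of the tuple holds [u_(j+t-i)]. *)
Definition p_local (A B : Type) (p : nat) (phi : (int -> A) -> (int -> B)) :
    Prop :=
  exists r t : nat, p = (r + t + 1)%N /\
    exists Phi : p.-tuple A -> B, forall (u : int -> A) (j : int),
      phi u j = Phi [tuple u (j + t%:Z - (i : nat)%:Z) | i < p].

Definition finitely_many_nonzero (K : nzRingType) (A : {fset K})
    (u : int -> A) : Prop :=
  finite_set [set j : int | val (u j) != 0].

(* Sum over all of [int]; it is the value of [u] only when
   [u] has finitely many nonzero digits (and is 0 by convention otherwise). *)
Definition value (K : fieldType) (beta : K) (A : {fset K}) (u : int -> A) : K :=
  \sum_(j \in [set: int]) val (u j) * beta ^ j.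

Definition digit_set_conversion (K : fieldType) (beta : K) (A B : {fset K})
    (phi : (int -> A) -> (int -> B)) : Prop :=
  [/\ 0 \in A, 0 \in B
    & forall u : int -> A, finitely_many_nonzero u ->
        finitely_many_nonzero (phi u) /\ value beta (phi u) = value beta u].

Definition allows_parallel_addition (K : fieldType) (beta : K) (A : {fset K}) :
    Prop :=
  exists phi : (int -> sumset A) -> (int -> A),
    digit_set_conversion beta phi /\ exists p : nat, p_local p phi.

(* Main.v *)
(** Existence.  Since [beta - a - beta^-1 = 0], a word [x] may be replaced by
    [x j - a * q j + q (j - 1) - q (j + 1)] for any quotient word [q].  It is
    enough to remove one extreme digit at a time; for an alphabet [lo .. hi]
    with [hi - lo = a + 1], a letter [hi + 1] is eliminated by local choices of
    [q], in three passes when [a >= 2] and in one pass when [a = 1].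

    Minimality.  Let [V] be a local conversion onto [m .. n], [n - m <= a], and
    suppose [n > 0] (otherwise negate).  The digit sum modulo [a] depends only
    on the value, as [beta] is irrational and each power of [beta] is
    [p + q * beta] with [p + q = 1] modulo [a].  Hence [V] sends the constant
    word [n] to a constant word [c] with [c = n] modulo [a], so [c] is [m] or
    [n].  Both are impossible: changing the letters [n] to [2 * n] or to [0] on
    a long block on the right moves the value arbitrarily far in one direction,
    while digits that are already extreme cannot follow. *)

Require Import Defs.
From HB Require Import structures.
From mathcomp Require Import all_boot all_order all_algebra.
From mathcomp Require Import finmap.
From mathcomp Require Import boolp classical_sets functions cardinality fsbigop.
From mathcomp Require Import reals complex.
From mathcomp Require Import zify ring.
Set Implicit Arguments.
Unset Strict Implicit.
Unset Printing Implicit Defensive.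
Import Order.TTheory GRing.Theory Num.Theory.
Local Open Scope ring_scope.

(** * Integer words, their values, and local conversions *)

(* Locality and shift invariance in a single condition. *)
Definition local_map (F : (int -> int) -> int -> int) : Prop :=
  exists r : nat, forall (u v : int -> int) (i j : int),
    (forall k : int, - r%:Z <= k <= r%:Z -> u (i + k) = v (j + k)) ->
    F u i = F v j.

Definition supported (N : nat) (u : int -> int) : Prop :=
  forall j : int, ~~ (- N%:Z <= j < N%:Z) -> u j = 0.

Definition finsupp (u : int -> int) : Prop := exists N, supported N u.

Definition zval (K : fieldType) (beta : K) (u : int -> int) : K :=
  \sum_(j \in [set: int]) (u j)%:~R * beta ^ j.

Definition digits_in (m n : int) (u : int -> int) : Prop :=
  forall j, m <= u j <= n.

(** Digits are constrained on all words but values only on finite ones, so that a conversion can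
    also be fed constant words. *)
Definition converts (K : fieldType) (beta : K) (F : (int -> int) -> int -> int)
    (P P' : (int -> int) -> Prop) : Prop :=
  local_map F /\ forall u, P u ->
    P' (F u) /\ (finsupp u -> finsupp (F u) /\ zval beta (F u) = zval beta u).

Lemma supported_leq (M N : nat) (u : int -> int) :
  (M <= N)%N -> supported M u -> supported N u.
Proof. by move=> MN uM j jN; apply: uM; lia. Qed.

Lemma local_map_comp F G : local_map F -> local_map G -> local_map (F \o G).
Proof.
move=> [r Fr] [s Gs]; exists (r + s)%N => u v i j uv /=.
apply: Fr => k kr; apply: Gs => l ls; rewrite -!addrA; apply: uv; lia.
Qed.

Lemma local_map_cst F (b i j : int) :
  local_map F -> F (fun=> b) i = F (fun=> b) j.
Proof. by move=> [r Fr]; apply: Fr. Qed.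

Lemma local_map_finsupp F u :
  local_map F -> (forall j, F (fun=> 0) j = 0) -> finsupp u -> finsupp (F u).
Proof.
move=> [r Fr] F0 [N uN]; exists (N + r)%N => j jN.
by rewrite -(F0 j); apply: Fr => k kr; apply: uN; lia.
Qed.

Lemma zval_window (K : fieldType) (beta : K) (N : nat) u : supported N u ->
  zval beta u =
    \sum_(0 <= k < N.*2) (u (k%:Z - N%:Z))%:~R * beta ^ (k%:Z - N%:Z).
Proof.
move=> uN; pose r : seq int := [seq k%:Z - N%:Z | k <- index_iota 0 N.*2].
have ur : uniq r by rewrite map_inj_uniq ?iota_uniq// => x y; lia.
rewrite /zval -(@fsbig_widen _ _ _ _ [set` r])//; last first.
  move=> j [_ /= jr]; rewrite uN ?mul0r//; apply/negP => jN; apply: jr.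
  apply/mapP; exists (absz (j + N%:Z)); last lia.
  by rewrite mem_index_iota; lia.
by rewrite -fsbig_seq// big_map.
Qed.

Lemma zvalD (K : fieldType) (beta : K) u v : finsupp u -> finsupp v ->
  zval beta (fun j => u j + v j) = zval beta u + zval beta v.
Proof.
move=> [M uM] [N vN].
have uMN := supported_leq (leq_addr N M) uM.
have vMN := supported_leq (leq_addl M N) vN.
rewrite (zval_window beta uMN) (zval_window beta vMN).
rewrite (@zval_window _ _ (M + N)).
  by rewrite -big_split; apply: eq_bigr => k _; rewrite intrD mulrDl.
by move=> j jMN; rewrite uMN// vMN.
Qed.

Lemma zvalZ (K : fieldType) (beta : K) c u :
  zval beta (fun j => c * u j) = c%:~R * zval beta u.
Proof.
rewrite /zval mulr_fsumr; apply: eq_fsbigr => j _; by rewrite intrM mulrA.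
Qed.

Lemma finsuppD u v : finsupp u -> finsupp v -> finsupp (fun j => u j + v j).
Proof.
move=> [M uM] [N vN]; exists (M + N)%N => j jN.
by rewrite uM ?vN//; lia.
Qed.

Lemma finsuppZ c u : finsupp u -> finsupp (fun j => c * u j).
Proof. by move=> [N uN]; exists N => j jN; rewrite uN ?mulr0. Qed.

Lemma finsupp_shift c u : finsupp u -> finsupp (fun j => u (j + c)).
Proof.
by move=> [N uN]; exists (N + absz c)%N => j jN; apply: uN; lia.
Qed.

Lemma zval_shift (K : fieldType) (beta : K) c u : beta != 0 ->
  zval beta (fun j => u (j + c)) = beta ^ (- c) * zval beta u.
Proof.
move=> b0; rewrite [in RHS]/zval (reindex_fsbigT (fun j => j + c)); last first.
  by exists (fun j => j - c) => j; rewrite ?addrK ?subrK.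
rewrite mulr_fsumr; apply: eq_fsbigr => j _.
by rewrite mulrCA -expfzDr// (_ : - c + (j + c) = j)//; lia.
Qed.

Lemma converts_comp (K : fieldType) (beta : K) F G P P' P'' :
  converts beta F P P' -> converts beta G P' P'' ->
  converts beta (G \o F) P P''.
Proof.
move=> [lF cF] [lG cG]; split; first exact: local_map_comp.
move=> u /cF[/cG[P''u vG] vF]; split=> // fu.
by have [/vG[? /= ->] <-] := vF fu.
Qed.

Lemma zvalN (K : fieldType) (beta : K) u :
  zval beta (fun j => - u j) = - zval beta u.
Proof.
rewrite -[RHS]mulN1r -(zvalZ beta (-1) u).
by congr zval; apply/funext => j; lia.
Qed.

Lemma finsuppN u : finsupp u -> finsupp (fun j => - u j).
Proof. by move=> [N uN]; exists N => j jN; rewrite uN ?oppr0. Qed.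

(** Negation exchanges the two ends of an alphabet, so only highest digits need a direct
    treatment. *)
Lemma converts_opp (K : fieldType) (beta : K) F m n m' n' :
  converts beta F (digits_in m n) (digits_in m' n') ->
  converts beta (fun u j => - F (fun k => - u k) j)
    (digits_in (- n) (- m)) (digits_in (- n') (- m')).
Proof.
move=> [[r Fr] cF]; split.
  by exists r => u v i j uv; congr (- _); apply: Fr => k /uv ->.
move=> u Pu; have [|PF vF] := cF (fun k => - u k).
  by move=> j; have := Pu j; lia.
split; first by move=> j; have := PF j; lia.
by move=> /finsuppN/vF[/finsuppN ? vu]; rewrite zvalN vu zvalN opprK.
Qed.

(** * Elimination of one extreme digit *)

Definition carry (a : int) (Q : (int -> int) -> int -> int) (x : int -> int)
    (j : int) : int :=
  x j - a * Q x j + Q x (j - 1) - Q x (j + 1).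

Lemma local_carry a Q : local_map Q -> local_map (carry a Q).
Proof.
move=> [r Qr]; exists r.+1 => u v i j uv; rewrite /carry.
congr (_ - _ * _ + _ - _).
- by have := uv 0; rewrite !addr0; apply.
- by apply: Qr => k kr; apply: uv; lia.
- by apply: Qr => k kr; rewrite -!addrA; apply: uv; lia.
- by apply: Qr => k kr; rewrite -!addrA; apply: uv; lia.
Qed.

Lemma base_neq0 (K : fieldType) (beta : K) (a : int) :
  beta ^+ 2 = a%:~R * beta + 1 -> beta != 0.
Proof.
move=> be; apply/eqP => b0; move: be; rewrite b0 expr2 !mulr0 add0r => /esym/eqP.
by rewrite oner_eq0.
Qed.

Lemma converts_carry (K : fieldType) (beta : K) (a : int) Q
    (P P' : (int -> int) -> Prop) :
  beta ^+ 2 = a%:~R * beta + 1 -> local_map Q ->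
  (forall j, Q (fun=> 0) j = 0) -> (forall x, P x -> P' (carry a Q x)) ->
  converts beta (carry a Q) P P'.
Proof.
move=> be lQ Q0 PP'; split; first exact: local_carry.
move=> u /PP'; split=> // fu; have b0 := base_neq0 be.
have fQ := local_map_finsupp lQ Q0 fu.
have -> : carry a Q u = fun j => (u j + (- a) * Q u j) +
    (Q u (j + (-1)) + (-1) * Q u (j + 1)).
  by apply/funext => j; rewrite /carry; lia.
have f1 := finsupp_shift (-1) fQ; have f2 := finsupp_shift 1 fQ.
have f3 := finsuppZ (- a) fQ; have f4 := finsuppZ (-1) f2.
have f5 := finsuppD fu f3; have f6 := finsuppD f1 f4.
split; first exact: finsuppD.
rewrite !zvalD // !zvalZ !zval_shift // opprK expr1z exprN1.
rewrite -[RHS]addr0 -addrA; congr (_ + _).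
(* Multiplied by [beta], the correction is [beta ^+ 2 - a * beta - 1] times the value of [Q u]. *)
apply: (mulfI b0); rewrite mulr0.
have -> : beta * ((- a)%:~R * zval beta (Q u) + (beta * zval beta (Q u) +
   (-1)%:~R * (beta^-1 * zval beta (Q u)))) =
  (beta ^+ 2 - a%:~R * beta - 1) * zval beta (Q u).
  by rewrite !intrN; field.
by rewrite be; ring.
Qed.

(* [lo <= 0 < hi] are the extreme digits of the target alphabet, and a letter
   [hi + 1] is to be eliminated.  The first pass may create letters [lo - 1],
   but only in the contexts recorded by [underflow_ok]; the next two passes
   remove them. *)
Definition carry_high (hi : int) (x : int -> int) (j : int) : int :=
  if (hi <= x j) && ~~ [&& x j == hi, hi <= x (j + 1) & x (j - 1) < hi]
  then 1 else 0.

Definition carry_low_high (lo hi : int) (x : int -> int) (j : int) : int :=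
  if (x j == lo - 1) && (x (j - 1) < hi) then -1
  else if (x j == hi) && (x (j + 1) == lo - 1) then 1 else 0.

Definition carry_low (lo : int) (x : int -> int) (j : int) : int :=
  if x j == lo - 1 then -1 else 0.

Definition underflow_ok (lo hi : int) (x : int -> int) : Prop :=
  digits_in (lo - 1) hi x /\
  forall j, x j = lo - 1 ->
    lo + 1 <= x (j + 1) /\ (x (j - 1) = hi -> lo + 1 <= x (j - 2)).

Definition underflow_mild (lo hi : int) (x : int -> int) : Prop :=
  digits_in (lo - 1) hi x /\
  forall j, x j = lo - 1 -> lo + 1 <= x (j + 1) /\ x (j - 1) < hi.

(** An underflow at [j] comes from a letter [lo] with a carry at [j + 1] only. The exception in
    [carry_high] did not apply at [j + 1], so the letter there is [hi + 1], or [hi] with no carry at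
    [j + 2]; it ends at [lo + 1] or more. *)
Lemma carry_high_underflow_ok (a lo hi : int) x :
  2 <= a -> hi - lo = a + 1 -> digits_in lo (hi + 1) x ->
  underflow_ok lo hi (carry a (carry_high hi) x).
Proof.
move=> a2 hl xd.
have e1 (j : int) : j - 1 - 1 = j - 2 by lia.
have e2 (j : int) : j + 1 + 1 = j + 2 by lia.
have e3 (j : int) : j - 2 - 1 = j - 3 by lia.
have e4 (j : int) : j - 2 + 1 = j - 1 by lia.
have e5 (j : int) : j + 1 - 1 = j by lia.
have e7 (j : int) : j + 2 - 1 = j + 1 by lia.
have e6 (j : int) : j - 1 + 1 = j by lia.
set q := carry_high hi x.
have qP j : q j = 1 /\ hi <= x j /\
     (x j = hi -> x (j + 1) < hi \/ hi <= x (j - 1))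
   \/ q j = 0 /\ (hi <= x j -> x j = hi /\ hi <= x (j + 1) /\ x (j - 1) < hi).
  by rewrite /q /carry_high; move: (xd j); case: ifP; lia.
rewrite /underflow_ok /digits_in /carry -/q; split=> j.
  have := qP (j + 1); have := qP (j - 1); rewrite !e5 !e6.
  move: (xd j) (xd (j + 1)) (xd (j - 1)).
  by move: (qP j) => [] [-> ?] [] ? ? ? [[-> ?]|[-> ?]] [[-> ?]|[-> ?]]; lia.
rewrite !e5 !e6 !e1 !e2 !e3 !e4 => xj.
have qj : q j = 0 /\ q (j - 1) = 0 /\ q (j + 1) = 1 /\ x j = lo.
  have := qP j; have := qP (j + 1); have := qP (j - 1).
  move: (xd j) => xdj [] [q1 ?] [] [q2 ?] [] [q3 ?]; move: xj; rewrite q1 q2 q3; lia.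
move: qj => [qj [qj1 [qj2 xj0]]].
have := qP (j + 1); have := qP (j - 1); rewrite qj qj1 qj2 e5 e6 !e1 !e2.
move=> [] [? P1] // [] [? P2] //; split.
  have := qP (j + 2); have := xd (j + 1); have := xd (j + 2).
  by rewrite e7 => ? ? [] [-> ?]; lia.
(* A new digit [hi] at [j - 1] needs a carry from [j - 2]; the letter there was at least [hi], loses
   only [a], and ends at [hi - a = lo + 1] or more. *)
move=> xj1; have q2 : q (j - 2) = 1 /\ x (j - 1) = hi - 1.
  move: (qP (j - 2)) (xd (j - 1)) xj1 => q2 ?.
  by case: q2 => [] [-> ?]; lia.
have := qP (j - 2); have := xd (j - 2); move: q2 => [-> ?].
by have := qP (j - 3) => + ? [] [] // ? ?; move=> [] [-> ?]; lia.
Qed.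

(** An underflow at [j] is cancelled by a carry [-1] at [j], or by a carry [1] at [j - 1] when the
    letter there is [hi]. New underflows arise only from a letter [lo + 1] with [-1] below it and
    [1] above it; its neighbours then become [hi - 2] and [lo + 1]. *)
Lemma carry_low_high_underflow_mild (a lo hi : int) x :
  2 <= a -> hi - lo = a + 1 -> underflow_ok lo hi x ->
  underflow_mild lo hi (carry a (carry_low_high lo hi) x).
Proof.
move=> a2 hl [xd xu].
have e1 (j : int) : j - 1 - 1 = j - 2 by lia.
have e2 (j : int) : j + 1 + 1 = j + 2 by lia.
have e5 (j : int) : j + 1 - 1 = j by lia.
have e6 (j : int) : j - 1 + 1 = j by lia.
have e7 (j : int) : j + 2 - 1 = j + 1 by lia.
set q := carry_low_high lo hi x.
have qP j : q j = -1 /\ x j = lo - 1 /\ x (j - 1) < hi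
   \/ q j = 1 /\ x j = hi /\ x (j + 1) = lo - 1
   \/ q j = 0 /\ (x j = lo - 1 -> hi <= x (j - 1)) /\
        (x j = hi -> x (j + 1) <> lo - 1).
  rewrite /q /carry_low_high; case: ifP => ?; first lia.
  by case: ifP => ?; lia.
have uP j : x j = lo - 1 -> [/\ q j = -1, q (j - 1) = 0 & q (j + 1) = 0] \/
    [/\ q j = 0, x (j - 1) = hi, q (j - 1) = 1 & q (j + 1) = 0].
  move=> xj; have := xu j xj; have := qP (j + 1); have := qP (j - 1).
  have := xu (j - 1); have := xu (j + 1); have := qP j.
  rewrite e5 e6 e2 e1 => qj xj1 xj2 qj1 qj2 uj.
  have ? := xd (j - 1); have ? := xu (j + 2); move: (xu (j + 2)); rewrite e7.
  have -> : j + 2 - 2 = j by lia.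
  move=> xj3; have [ej|ej] : q j = -1 \/ q j = 0 by lia.
    by left; split=> //; lia.
  by right; split=> //; lia.
(* Where no carry is emitted, the only failure is a letter [lo + 1] that loses 1 to each side. *)
have zP j : q j = 0 -> lo <= x j ->
    lo <= x j + q (j - 1) - q (j + 1) <= hi \/
    [/\ x j = lo + 1, q (j - 1) = -1 & q (j + 1) = 1].
  move=> qj xj.
  have := xd j; have := qP (j - 1); have := qP (j + 1); rewrite e5 e6 e2 e1.
  have := xu (j - 1); have := xu (j + 2); rewrite e6 e7.
  have -> : j + 2 - 2 = j by lia.
  move=> xu2 xu1 q2 q1 xdj.
  have [eq1|[eq1|eq1]] : q (j - 1) = -1 \/ q (j - 1) = 1 \/ q (j - 1) = 0 by lia.
  - have [eq2|[eq2|eq2]] : q (j + 1) = -1 \/ q (j + 1) = 1 \/ q (j + 1) = 0 by lia.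
    + by left; lia.
    + have [|xj1] := eqVneq (x j) (lo + 1); first by right.
      by left; lia.
    + by left; lia.
  - lia.
  - by left; rewrite eq1 addr0; lia.
split=> j; rewrite /carry -/q.
  case: (qP j) => [[qj [xj _]]|[[qj [xj xj1]]|[qj _]]].
  - by case: (uP j xj); rewrite qj => -[// _ -> ->]; lia.
  - case: (uP _ xj1); rewrite e5 e2 qj => -[// -> _ _ _].
    by have := qP (j - 1); lia.
  - have [xj|xj] := eqVneq (x j) (lo - 1).
      by case: (uP j xj); rewrite qj xj => -[// _ _ -> ->]; lia.
    have xj0 : lo <= x j by have := xd j; lia.
    by case: (zP j qj xj0) => [|[-> -> ->]]; lia.
rewrite e2 e5 e6 e1 => zj.
have [qj xj0] : q j = 0 /\ lo <= x j.
  case: (qP j) => [[qj [xj _]]|[[qj [xj xj1]]|[qj _]]].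
  - by case: (uP j xj); rewrite qj => -[// _ e e']; move: zj; rewrite e e'; lia.
  - case: (uP _ xj1); rewrite e5 e2 qj => -[// e _ _ _].
    by move: zj; rewrite e qj; have := qP (j - 1); lia.
  - split=> //; have := xd j; have [xj|xj] := eqVneq (x j) (lo - 1); last lia.
    by case: (uP j xj); rewrite qj => -[// _ _ e e']; move: zj; rewrite e e'; lia.
case: (zP j qj xj0) => [|[xj q1 q2]]; first by move: zj; rewrite qj; lia.
rewrite q1 q2 qj; split.
  have [x1 x2] : x (j + 1) = hi /\ x (j + 2) = lo - 1.
    by have := qP (j + 1); rewrite q2 e2; lia.
  case: (uP _ x2); rewrite e7 q2 => -[]//.
  by move=> -> *; lia.
have x1 : x (j - 1) = lo - 1 by have := qP (j - 1); rewrite q1; lia.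
by case: (uP _ x1); rewrite q1 e1 => -[// _ -> _]; lia.
Qed.

Lemma local_carry_high hi : local_map (carry_high hi).
Proof.
exists 1%N => u v i j uv; rewrite /carry_high.
by have := uv 0 isT; rewrite !addr0 => ->; rewrite !uv.
Qed.

Lemma local_carry_low_high lo hi : local_map (carry_low_high lo hi).
Proof.
exists 1%N => u v i j uv; rewrite /carry_low_high.
by have := uv 0 isT; rewrite !addr0 => ->; rewrite !uv.
Qed.

Lemma local_carry_low lo : local_map (carry_low lo).
Proof.
exists 0%N => u v i j uv; rewrite /carry_low.
by have := uv 0 isT; rewrite !addr0 => ->.
Qed.

(** The remaining underflows are never adjacent, and their neighbours have room for the borrowed
    units, so all can be removed at once. *)
Lemma carry_low_digits (a lo hi : int) x :
  2 <= a -> hi - lo = a + 1 -> underflow_mild lo hi x ->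
  digits_in lo hi (carry a (carry_low lo) x).
Proof.
move=> a2 hl [xd xu] j; rewrite /carry /carry_low.
have e5 (i : int) : i + 1 - 1 = i by lia.
have e6 (i : int) : i - 1 + 1 = i by lia.
move: (xd j) (xu j) (xu (j - 1)) (xu (j + 1)); rewrite e5 e6.
do 3![case: ifP => ?]; lia.
Qed.

Definition golden_core (hi : int) (x : int -> int) (j : int) : bool :=
  (x j == hi + 1) || (hi <= x j) && ((hi <= x (j - 2)) || (hi <= x (j + 2))).

Definition golden_quotient (hi : int) (x : int -> int) (j : int) : int :=
  if golden_core hi x j ||
     [&& x j == hi - 1, golden_core hi x (j - 2) & golden_core hi x (j + 2)]
  then 1 else 0.

(* [X^2 - 3 + X^-2 = (X - 1 - X^-1) (X + 1 - X^-1)], so that this quotient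
   rewrites with [3 = beta^2 + beta^-2] when [beta^2 = beta + 1]. *)
Definition golden_carry (hi : int) (x : int -> int) (j : int) : int :=
  golden_quotient hi x (j - 1) + golden_quotient hi x j
    - golden_quotient hi x (j + 1).

Lemma local_golden_carry hi : local_map (golden_carry hi).
Proof.
have lq : local_map (golden_quotient hi).
  exists 4%N => u v i j uv.
  have := uv 0 isT; rewrite !addr0 => uv0.
  have e k l : - 4%:Z <= k + l <= 4 -> u (i + k + l) = v (j + k + l).
    by move=> kl; rewrite -!addrA uv.
  by rewrite /golden_quotient /golden_core uv0 !uv // !e.
move: lq => [r lq]; exists r.+1 => u v i j uv; rewrite /golden_carry.
congr (_ + _ - _); apply: lq => k kr; rewrite -?addrA; apply: uv; lia.
Qed.

(** Each parity class of positions evolves separately: quotient 1 costs 3 and gives 1 at distance 2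
    on both sides. A core letter [hi] has another core letter at distance 2 and regains at least 1;
    a letter [hi - 1] with quotient 1 regains 2. With quotient 0, a letter [hi] receives nothing and
    a letter [hi - 1] at most 1. *)
Lemma golden_carry_digits (lo hi : int) x :
  hi - lo = 2 -> digits_in lo (hi + 1) x ->
  digits_in lo hi (carry 1 (golden_carry hi) x).
Proof.
move=> hl xd j; set q := golden_quotient hi x; set c := golden_core hi x.
have e5 (i : int) : i + 2 - 2 = i by lia.
have e6 (i : int) : i - 2 + 2 = i by lia.
have -> : carry 1 (golden_carry hi) x j = x j - 3 * q j + q (j - 2) + q (j + 2).
  rewrite /carry /golden_carry -/q.
  have -> : j + 1 - 1 = j by lia.
  have -> : j - 1 + 1 = j by lia.
  have -> : j + 1 + 1 = j + 2 by lia.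
  have -> : j - 1 - 1 = j - 2 by lia.
  lia.
have cP i : c i <-> x i = hi + 1 \/
    hi <= x i /\ (hi <= x (i - 2) \/ hi <= x (i + 2)).
  by rewrite /c /golden_core; have := xd i; lia.
have qP i : q i = 1 /\ (c i \/ [/\ x i = hi - 1, c (i - 2) & c (i + 2)]) \/
    [/\ q i = 0, ~ c i & ~ (x i = hi - 1 /\ (c (i - 2) /\ c (i + 2)))].
  rewrite /q /golden_quotient -/c; case: ifP => [/orP h|/norP[/negP h1 /negP h2]].
    left; split=> //; case: h => [->|/and3P[/eqP]]; first by left.
    by right.
  right; split=> // -[xi [c1 c2]]; apply: h2; apply/and3P; split=> //.
  exact/eqP.
have cq i : c i -> q i = 1 by case: (qP i) => -[].
have cx i : c i -> hi <= x i by move/cP; lia.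
have q01 i : q i = 0 \/ q i = 1 by case: (qP i) => -[]; auto.
have := xd j; have := q01 (j - 2); have := q01 (j + 2).
case: (qP j) => -[-> h].
  move: h => [/cP[|[hj h]]|[xj /cq -> /cq ->]]; [lia| |lia].
  have [->|->] : q (j - 2) = 1 \/ q (j + 2) = 1; [|lia|lia].
  by case: h => h; [left|right]; apply: cq; apply/cP; rewrite ?e5 ?e6; lia.
move=> h2 q1 q2 xdj; have nh : x j <> hi + 1 by move=> xj; apply: h; apply/cP; left.
(* Used at [j - 2] and [j + 2]: a carry from outside the core would put [j] in the core. *)
have qc i : c i = false -> q i = 1 -> [/\ x i = hi - 1, c (i - 2) & c (i + 2)].
  by case: (qP i) => -[-> // [->|]].
have [xj|xj] := eqVneq (x j) hi.
  have n1 : x (j - 2) < hi.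
    by rewrite ltNge; apply/negP => ?; apply: h; apply/cP; lia.
  have n2 : x (j + 2) < hi.
    by rewrite ltNge; apply/negP => ?; apply: h; apply/cP; lia.
  have m1 : q (j - 2) = 0.
    case: (q01 (j - 2)) => // /qc[|_ _].
      by apply/negP => /cx; lia.
    by rewrite e6 => /h.
  have m2 : q (j + 2) = 0.
    case: (q01 (j + 2)) => // /qc[|_].
      by apply/negP => /cx; lia.
    by rewrite e5 => /h.
  lia.
have [xj1|xj1] := eqVneq (x j) (hi - 1); last lia.
suff : ~ (q (j - 2) = 1 /\ q (j + 2) = 1) by lia.
move=> [m1 m2]; apply: h2; split=> //; split.
  by apply/negPn/negP => /negbTE/qc/(_ m1)[_ _]; rewrite e6 => /h.
by apply/negPn/negP => /negbTE/qc/(_ m2)[_]; rewrite e5 => /h.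
Qed.

(** The bounds [lo <= 0] and [1 <= hi] make every quotient vanish on the zero word, as
    [converts_carry] requires. *)
Lemma eliminate_high (K : fieldType) (beta : K) (a lo hi : int) :
  beta ^+ 2 = a%:~R * beta + 1 -> 1 <= a -> lo <= 0 -> 1 <= hi ->
  hi - lo = a + 1 ->
  exists F, converts beta F (digits_in lo (hi + 1)) (digits_in lo hi).
Proof.
move=> be a1 lo0 hi1 hl; have [ea|a2] : a = 1 \/ 2 <= a by lia.
  subst a.
  exists (carry 1 (golden_carry hi)); apply: converts_carry => //.
  - exact: local_golden_carry.
  - have c0 i : golden_core hi (fun=> 0) i = false by rewrite /golden_core /=; lia.
    have q0 i : golden_quotient hi (fun=> 0) i = 0.
      by rewrite /golden_quotient !c0 !andbF.
    by move=> j; rewrite /golden_carry !q0.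
  - by move=> x; apply: golden_carry_digits; lia.
exists (carry a (carry_low lo) \o (carry a (carry_low_high lo hi) \o
        carry a (carry_high hi))).
apply: (converts_comp (P' := underflow_mild lo hi)); last first.
  apply: converts_carry => //; first exact: local_carry_low.
    by move=> j; rewrite /carry_low /=; case: ifP; lia.
  by move=> x; exact: carry_low_digits.
apply: (converts_comp (P' := underflow_ok lo hi)).
  apply: converts_carry => //; first exact: local_carry_high.
    by move=> j; rewrite /carry_high /=; case: ifP; lia.
  by move=> x; exact: carry_high_underflow_ok.
apply: converts_carry => //; first exact: local_carry_low_high.
  by move=> j; rewrite /carry_low_high /=; do ?case: ifP; lia.
by move=> x; exact: carry_low_high_underflow_mild.
Qed.

(** * From one extra letter to the doubled alphabet *)

Lemma reduce_high (K : fieldType) (beta : K) G (lo hi : int) (k l : nat) :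
  lo <= 0 -> 0 <= hi ->
  converts beta G (digits_in lo (hi + 1)) (digits_in lo hi) ->
  exists H, converts beta H (digits_in (lo - l%:Z) (hi + k%:Z))
    (digits_in (lo - l%:Z) hi).
Proof.
move=> lo0 hi0 [[r Gr] cG]; elim: k => [|k [H cH]].
  exists id; rewrite addr0; split; last by [].
  by exists 0%N => u v i j /(_ 0 isT); rewrite !addr0.
(* [G] acts on the word clamped to [lo .. hi + 1], and the part cut off is added back; this lowers
   the top letter by 1. Clamping fixes 0, so finite support survives. *)
pose cl (u : int -> int) j := if u j < lo then lo else
  if hi + 1 < u j then hi + 1 else u j.
pose S (u : int -> int) j := G (cl u) j + (u j - cl u j).
suff cS : converts beta S (digits_in (lo - l%:Z) (hi + k.+1%:Z))
    (digits_in (lo - l%:Z) (hi + k%:Z)).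
  by exists (H \o S); exact: converts_comp cS cH.
split=> [|u uP].
  exists r => u v i j uv; have uv0 : u i = v j.
    by have := uv 0; rewrite !addr0; apply; lia.
  rewrite /S /cl uv0; congr (_ + _); apply: Gr => m mr.
  by rewrite (uv m mr).
have clP : digits_in lo (hi + 1) (cl u) by move=> j; rewrite /cl; do ?case: ifP; lia.
have [GP Gv] := cG _ clP; split.
  by move=> j; rewrite /S; move: (GP j) (uP j); rewrite /cl; do ?case: ifP; lia.
move=> fu; have fcl : finsupp (cl u).
  by move: fu => [N uN]; exists N => j /uN; rewrite /cl; do ?case: ifP; lia.
have [fG vG] := Gv fcl.
have fd : finsupp (fun j => u j - cl u j).
  have -> : (fun j => u j - cl u j) = fun j => u j + (-1) * cl u j.
    by apply/funext => j; lia.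
  by apply: finsuppD => //; apply: finsuppZ.
split; first exact: finsuppD.
rewrite zvalD // vG -zvalD //; congr zval; apply/funext => j; lia.
Qed.

(** The top is reduced first, then the bottom after negation. When [hi] or [lo] is 0 the identity
    serves on that side, where [eliminate_high] would not apply. *)
Lemma parallel_addition_digits (K : fieldType) (beta : K) (a lo hi : int) :
  beta ^+ 2 = a%:~R * beta + 1 -> 1 <= a -> lo <= 0 -> 0 <= hi ->
  hi - lo = a + 1 ->
  exists F, converts beta F (digits_in (2 * lo) (2 * hi)) (digits_in lo hi).
Proof.
move=> be a1 lo0 hi0 hl.
have [F cF] : exists F,
    converts beta F (digits_in (2 * lo) (2 * hi)) (digits_in (2 * lo) hi).
  have [hi1|hi1] := leP 1 hi; last first.
    have -> : hi = 0 by lia.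
    exists id; rewrite mulr0; split; last by [].
    by exists 0%N => u v i j /(_ 0 isT); rewrite !addr0.
  have [G cG] := eliminate_high be a1 lo0 hi1 hl.
  have := reduce_high (absz hi) (absz lo) lo0 hi0 cG.
  have -> : lo - (absz lo)%:Z = 2 * lo by lia.
  have -> : hi + (absz hi)%:Z = 2 * hi by lia.
  by [].
have [G cG] : exists F,
    converts beta F (digits_in (2 * lo) hi) (digits_in lo hi).
  have [lo1|lo1] := leP 0 lo.
    have -> : lo = 0 by lia.
    exists id; rewrite mulr0; split; last by [].
    by exists 0%N => u v i j /(_ 0 isT); rewrite !addr0.
  have [|||G cG] := eliminate_high (lo := - hi) (hi := - lo) be a1; try lia.
  have [||H] := reduce_high (absz lo) 0 _ _ cG; try lia.
  move/converts_opp; rewrite subr0 !opprK.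
  have -> : - (- lo + (absz lo)%:Z) = 2 * lo by lia.
  by move=> ?; eexists; eassumption.
exists (G \o F); exact: converts_comp cF cG.
Qed.

(** * Images of constant words *)

(** [beta - a] is the inverse of [beta]. *)
Lemma base_bounds (K : numFieldType) (beta : K) (a : nat) :
  1 < beta -> beta ^+ 2 = a%:~R * beta + 1 -> 0 < beta - a%:~R < 1.
Proof.
move=> b1 be; have b0 : 0 < beta by apply: lt_trans b1.
have -> : beta - a%:~R = beta^-1.
  apply: (mulfI (lt0r_neq0 b0)); rewrite mulfV ?lt0r_neq0 // mulrBr -expr2 be.
  by rewrite [beta * _]mulrC addrAC subrr add0r.
by rewrite invr_gt0 b0 invf_lt1.
Qed.

(* Descent: if [y * beta] is an integer then so is [y' * beta] for
   [y' = y * (beta - a)], and [0 < y' < y]. *)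
Lemma base_irrational (K : numFieldType) (beta : K) (a : nat) (x y : int) :
  1 < beta -> beta ^+ 2 = a%:~R * beta + 1 ->
  x%:~R + y%:~R * beta = 0 -> x = 0 /\ y = 0.
Proof.
move=> b1 be; have /andP[ba0 ba1] := base_bounds b1 be.
have key (n : nat) (y' z : int) : (absz y' < n)%N -> 0 < y' ->
    y'%:~R * beta = z%:~R -> False.
  elim: n y' z => // n IH y' z y'n y'0 e.
  have e' : (z - a%:Z * y')%:~R = y'%:~R * (beta - a%:~R).
    by rewrite intrB intrM -e; ring.
  have y0 : 0 < y'%:~R :> K by rewrite ltr0z.
  have h0 : 0 < z - a%:Z * y' by rewrite -(ltr0z K) e' mulr_gt0.
  have h1 : z - a%:Z * y' < y' by rewrite -(ltr_int K) e' gtr_pMr.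
  apply: (IH (z - a%:Z * y') y' _ h0); first lia.
  by rewrite e' -mulrA mulrBl -expr2 be [_ + 1]addrC addrK mulr1.
move=> e; have [y0|y0|y0] := ltgtP y 0.
- case: (key (absz y).+1 (- y) x) => //; first lia; first lia.
  by rewrite intrN mulNr; apply/eqP; rewrite eq_sym -addr_eq0 e.
- case: (key (absz y).+1 y (- x)) => //.
  by rewrite intrN; apply/eqP; rewrite -addr_eq0 addrC e.
- by move: e; rewrite y0 mul0r addr0 => /eqP; rewrite intr_eq0 => /eqP.
Qed.

(** Horner's scheme: multiplication by [beta] turns [p + q * beta] into [q + (p + a * q) * beta],
    which changes the sum of the coefficients by [a * q]. *)
Lemma digit_sum_repr (K : fieldType) (beta : K) (a : int) (f : nat -> int) M :
  beta ^+ 2 = a%:~R * beta + 1 ->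
  exists p q s : int,
    \sum_(0 <= k < M) (f k)%:~R * beta ^+ k = p%:~R + q%:~R * beta /\
    p + q = \sum_(0 <= k < M) f k + a * s.
Proof.
move=> be; elim: M f => [|M IH] f.
  by exists 0, 0, 0; rewrite !big_geq // mul0r mulr0 addr0.
have [p [q [s [e1 e2]]]] := IH (f \o S).
exists (f 0%N + q), (p + a * q), (s + q); rewrite !big_nat_recl //.
rewrite expr0 mulr1; split; last by rewrite -!/((f \o S) _); move: e2 => /=; lia.
under eq_bigr do rewrite exprS mulrCA.
rewrite -mulr_sumr -!/((f \o S) _) e1 mulrDr mulrCA -expr2 be.
by rewrite !intrD !intrM; ring.
Qed.

(** By irrationality the coefficients [p] and [q] of equal values coincide, once the common factor
    [beta ^ (- N)] is cancelled. *)
Lemma digit_sum_congr (K : numFieldType) (beta : K) (a N : nat) u v :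
  1 < beta -> beta ^+ 2 = a%:~R * beta + 1 -> supported N u -> supported N v ->
  zval beta u = zval beta v ->
  exists s : int, \sum_(0 <= k < N.*2) u (k%:Z - N%:Z) =
    \sum_(0 <= k < N.*2) v (k%:Z - N%:Z) + a%:Z * s.
Proof.
move=> b1 be uN vN; have b0 := base_neq0 be.
have W w : supported N w -> zval beta w =
    beta ^ (- N%:Z) * \sum_(0 <= k < N.*2) (w (k%:Z - N%:Z))%:~R * beta ^+ k.
  move=> /zval_window ->; rewrite mulr_sumr; apply: eq_bigr => k _.
  by rewrite expfzDr // [RHS]mulrCA; congr (_ * _); rewrite mulrC.
rewrite !W // => /(mulfI _) e.
have {}e := e (expfz_neq0 _ b0); move: e.
have [p [q [s [-> e]]]] := digit_sum_repr (fun k => u (k%:Z - N%:Z)) N.*2 be.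
have [p' [q' [s' [-> e']]]] := digit_sum_repr (fun k => v (k%:Z - N%:Z)) N.*2 be.
move=> ee; have [|p0 q0] := @base_irrational _ beta a (p - p') (q - q') b1 be.
  have -> : (p - p')%:~R + (q - q')%:~R * beta =
      p%:~R + q%:~R * beta - (p'%:~R + q'%:~R * beta).
    by rewrite !intrB; ring.
  by rewrite ee subrr.
by exists (s' - s); lia.
Qed.

(** Serves to compare the images of two blocks whose lengths differ by one. *)
Lemma sum_insert (f f' : nat -> int) (p M : nat) (c : int) :
  (p <= M)%N -> (forall k, (k < p)%N -> f' k = f k) -> f' p = c ->
  (forall k, (p <= k)%N -> f' k.+1 = f k) ->
  \sum_(0 <= k < M.+1) f' k = \sum_(0 <= k < M) f k + c.
Proof.
move=> pM f1 <- f2; elim: M pM => [|M IH].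
  by rewrite leqn0 => /eqP p0; rewrite p0 big_nat1 big_geq // add0r.
rewrite leq_eqVlt => /orP[/eqP <-|].
  rewrite big_nat_recr //=; congr (_ + _); apply: eq_big_nat => k; exact: f1.
rewrite ltnS => pM; rewrite big_nat_recr //= IH //.
by rewrite [in RHS]big_nat_recr //= f2 // addrAC.
Qed.

(** * Size estimates and extreme digits *)

Lemma zval_le (K : numFieldType) (beta : K) u v :
  0 < beta -> finsupp u -> finsupp v -> (forall j, u j <= v j) ->
  zval beta u <= zval beta v.
Proof.
move=> b0 [M uM] [N vN] uv.
have uMN := supported_leq (leq_addr N M) uM.
have vMN := supported_leq (leq_addl M N) vN.
rewrite (zval_window beta uMN) (zval_window beta vMN); apply: ler_sum => k _.
by rewrite ler_wpM2r ?ler_int // exprz_ge0 // ltW.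
Qed.

Definition block (b : int) (l h : int) (j : int) : int :=
  if l <= j < h then b else 0.

Lemma finsupp_block b l h : finsupp (block b l h).
Proof. by exists (absz l + absz h)%N => j; rewrite /block; case: ifP; lia. Qed.

Lemma zval_block_ge (K : numFieldType) (beta : K) (N : nat) :
  1 < beta -> N%:~R <= zval beta (block 1 0 N).
Proof.
move=> b1; rewrite (@zval_window _ _ N); last first.
  by move=> j; rewrite /block; case: ifP; lia.
rewrite (@big_cat_nat _ _ _ N) //=; last by rewrite -addnn leq_addr.
have b0 : 0 < beta by apply: lt_trans b1.
rewrite -[leLHS]add0r lerD //.
  apply: sumr_ge0 => k _; rewrite mulr_ge0 ?exprz_ge0 ?(ltW b0) // ler0z.
  by rewrite /block; case: ifP.
have -> : N%:~R = \sum_(N <= k < N.*2) 1 :> K.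
  by rewrite sumr_const_nat -addnn addnK.
apply: ler_sum_nat => k kN.
rewrite /block (_ : _ <= _ < _) ?mul1r; last lia.
have -> : k%:Z - N%:Z = (k - N)%N by lia.
by rewrite -exprnP exprn_ege1 // ltW.
Qed.

(** Crude: each of the [r.*2] powers is at most [beta ^+ r], and [beta <= a + 1]. A natural number
    as bound lets the final comparison take place in the integers. *)
Lemma zval_block_le (K : numFieldType) (beta : K) (a r d : nat) :
  1 < beta -> beta ^+ 2 = a%:~R * beta + 1 ->
  zval beta (block d (- r%:Z) r) <= (r.*2 * (d * a.+1 ^ r))%N%:~R.
Proof.
move=> b1 be; rewrite (@zval_window _ _ r); last first.
  by move=> j; rewrite /block; case: ifP; lia.
have b0 : 0 < beta by apply: lt_trans b1.
have ba : beta <= a.+1%:R.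
  have /andP[_ /ltW] := base_bounds b1 be.
  by rewrite lerBlDr addrC natr1.
have -> : (r.*2 * (d * a.+1 ^ r))%N%:~R =
    \sum_(0 <= k < r.*2) (d%:R * a.+1%:R ^+ r) :> K.
  by rewrite sumr_const_nat subn0 -natrX -natrM -mulrnA -pmulrn mulnC.
apply: ler_sum_nat => k kr.
rewrite /block (_ : _ <= _ < _); last lia.
apply: ler_wpM2l; first exact: ler0n.
apply: (@le_trans _ _ (beta ^+ r)); last first.
  by apply: lerXn2r => //; rewrite nnegrE ?ler0n // ltW.
have -> : beta ^+ r = beta ^ (k%:Z - r%:Z) * beta ^+ (r.*2 - k).
  by rewrite !exprnP -expfzDr ?gt_eqF //; congr (_ ^ _); lia.
by rewrite ler_peMr ?exprz_ge0 ?exprn_ege1 // ltW.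
Qed.

(** The image of the zero word is constant by locality and has finite support. *)
Lemma finsupp_cst_converts (K : fieldType) (beta : K) F
    (P P' : (int -> int) -> Prop) :
  converts beta F P P' -> P (fun=> 0) -> forall j, F (fun=> 0) j = 0.
Proof.
move=> [lF cF] /cF[_ []]; first by exists 0%N.
by move=> [N FN] _ j; rewrite (local_map_cst _ j N%:Z lF) FN //; lia.
Qed.

(* A constant word of letters [b] is sent to the constant word [n] of largest
   digits; replacing [b] by [e] to the right increases the value by at least
   [K], but the image can only increase in a window of bounded width. *)
Lemma cst_neq_max (K : numFieldType) (beta : K) (a : nat) V
    (B0 B1 m n b e : int) :
  1 < beta -> beta ^+ 2 = a%:~R * beta + 1 ->
  converts beta V (digits_in B0 B1) (digits_in m n) ->
  B0 <= 0 <= B1 -> B0 <= b <= B1 -> B0 <= e <= B1 -> b < e ->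
  V (fun=> b) 0 <> n.
Proof.
move=> b1 be cV B01 bB eB be' Vb.
have V0 j : V (fun=> 0) j = 0 by apply: (finsupp_cst_converts cV) => i.
have := cV => -[lV]; have [r Vr] := lV; move=> vV.
(* [k] is one more than the bound of [zval_block_le]. The [r.*2] further letters [b] keep the
   windows of [u1] centred in [r .. k + r - 1] inside the constant block. *)
pose d := absz (n - m); pose k := (r.*2 * (d * a.+1 ^ r)).+1.
pose u1 := block b 0 (k + r.*2)%N.
pose u2 j := block e 0 k j + block b k (k + r.*2)%N j.
have f1 : finsupp u1 by exact: finsupp_block.
have f2 : finsupp u2 by apply: finsuppD; exact: finsupp_block.
have P1 : digits_in B0 B1 u1 by move=> j; rewrite /u1 /block; case: ifP; lia.
have P2 : digits_in B0 B1 u2.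
  by move=> j; rewrite /u2 /block; do 2![case: ifP]; lia.
have [D1 /(_ f1)[g1 z1]] := vV _ P1; have [D2 /(_ f2)[g2 z2]] := vV _ P2.
have nf u : finsupp u -> finsupp (fun j => - u j) := @finsuppN u.
have zu : zval beta (V u2) - zval beta (V u1) = zval beta u2 - zval beta u1.
  by rewrite z1 z2.
have low : k%:~R <= zval beta u2 - zval beta u1.
  apply: (le_trans (zval_block_ge k b1)); rewrite -zvalN -zvalD //; last exact: nf.
  apply: zval_le => //; first by apply: lt_trans b1.
  - exact: finsupp_block.
  - by apply: finsuppD => //; exact: nf.
  by move=> j; rewrite /u1 /u2 /block; do ![case: ifP]; lia.
have up : zval beta (V u2) - zval beta (V u1) <= k.-1%:~R.
  apply: le_trans (zval_block_le r d b1 be); rewrite -zvalN -zvalD //; last exact: nf.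
  apply: zval_le => //; first by apply: lt_trans b1.
  - by apply: finsuppD => //; exact: nf.
  - exact: finsupp_block.
  (* The gain is at most [n - m] on [- r .. r - 1]. Below, both images vanish; up to [k + r - 1],
     [V u1] is already [n]; beyond, the two words have equal windows. *)
  move=> j; rewrite /block; case: ifP => jr.
    by have := D1 j; have := D2 j; rewrite /d; lia.
  have [j0|j0] := ltP j (- r%:Z).
    have e1 : V u1 j = 0.
      by rewrite -(V0 j); apply: Vr => i ir; rewrite /u1 /block; case: ifP; lia.
    have e2 : V u2 j = 0.
      by rewrite -(V0 j); apply: Vr => i ir; rewrite /u2 /block; do ![case: ifP]; lia.
    by rewrite e1 e2; lia.
  have [j1|j1] := ltP j (k + r)%N.
    have -> : V u1 j = n.
      rewrite -Vb; apply: Vr => i ir; rewrite /u1 /block; case: ifP; lia.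
    by have := D2 j; lia.
  have -> : V u1 j = V u2 j.
    by apply: Vr => i ir; rewrite /u1 /u2 /block; do ![case: ifP]; lia.
  by lia.
have := le_trans low (le_trans _ up); rewrite zu lexx => /(_ isT).
by rewrite ler_int /k; lia.
Qed.

Lemma cst_neq_min (K : numFieldType) (beta : K) (a : nat) V
    (B0 B1 m n b e : int) :
  1 < beta -> beta ^+ 2 = a%:~R * beta + 1 ->
  converts beta V (digits_in B0 B1) (digits_in m n) ->
  B0 <= 0 <= B1 -> B0 <= b <= B1 -> B0 <= e <= B1 -> e < b ->
  V (fun=> b) 0 <> m.
Proof.
move=> b1 be /converts_opp cV B01 bB eB eb Vb.
apply: (cst_neq_max (b := - b) (e := - e) b1 be cV); try lia.
by rewrite -Vb; congr (- V _ 0); apply/funext => j; rewrite opprK.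
Qed.

(** Lengthening a block of letters [b] from [r.*2] to [r.*2.+1] inserts one digit [V (fun=> b) 0] at
    position [r] of its image. The digit sums thus grow by [b] and by this digit, which must agree
    modulo [a]. *)
Lemma cst_congr (K : numFieldType) (beta : K) (a : nat) V (B0 B1 m n b : int) :
  1 < beta -> beta ^+ 2 = a%:~R * beta + 1 ->
  converts beta V (digits_in B0 B1) (digits_in m n) ->
  B0 <= 0 <= B1 -> B0 <= b <= B1 ->
  exists s : int, V (fun=> b) 0 = b + a%:Z * s.
Proof.
move=> b1 be cV B01 bB.
have V0 j : V (fun=> 0) j = 0 by apply: (finsupp_cst_converts cV) => i.
have := cV => -[lV]; have [r Vr] := lV; move=> vV.
pose u := block b 0 r.*2; pose u' := block b 0 r.*2.+1.
have P1 : digits_in B0 B1 u by move=> j; rewrite /u /block; case: ifP; lia.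
have P2 : digits_in B0 B1 u' by move=> j; rewrite /u' /block; case: ifP; lia.
have [_ /(_ (finsupp_block _ _ _))[_ z1]] := vV _ P1.
have [_ /(_ (finsupp_block _ _ _))[_ z2]] := vV _ P2.
(* The last position of the window is then [3 * r], where the shorter word and its image vanish, so
   the insertion loses nothing. *)
pose N := (r + r + r).+1.
have s1 : supported N u by move=> j; rewrite /u /N /block; case: ifP; lia.
have s2 : supported N u' by move=> j; rewrite /u' /N /block; case: ifP; lia.
have s3 : supported N (V u).
  move=> j jN; rewrite -(V0 j); apply: Vr => i ir.
  by rewrite /u /block; case: ifP; lia.
have s4 : supported N (V u').
  move=> j jN; rewrite -(V0 j); apply: Vr => i ir.
  by rewrite /u' /block; case: ifP; lia.
have [t1 e1] := digit_sum_congr b1 be s3 s1 z1.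
have [t2 e2] := digit_sum_congr b1 be s4 s2 z2.
have ins (w w' : int -> int) (c : int) : w (3 * r)%N%:Z = 0 ->
    (forall j : int, j < r%:Z -> w' j = w j) -> w' r%:Z = c ->
    (forall j : int, r%:Z <= j -> w' (j + 1) = w j) ->
    \sum_(0 <= k < N.*2) w' (k%:Z - N%:Z) =
    \sum_(0 <= k < N.*2) w (k%:Z - N%:Z) + c.
  move=> w0 w1 w2 w3; have -> : N.*2 = (N + N).-1.+1 by rewrite /N; lia.
  rewrite (@sum_insert (fun k => w (k%:Z - N%:Z)) _ (N + r) _ c).
  - rewrite [in RHS]big_nat_recr //= (_ : _ - _ = (3 * r)%N%:Z); last first.
      by rewrite /N; lia.
    by rewrite w0 addr0.
  - by rewrite /N; lia.
  - by move=> k kN; apply: w1; lia.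
  - by rewrite -w2; congr w'; lia.
  - by move=> k kN; rewrite -w3; [congr w'|]; lia.
have i1 := ins u u' b.
have i2 := ins (V u) (V u') (V (fun=> b) 0).
rewrite i1 in e2; last first.
- by move=> j; rewrite /u /u' /block; do ![case: ifP]; lia.
- by rewrite /u' /block; case: ifP; lia.
- by move=> j; rewrite /u /u' /block; do ![case: ifP]; lia.
- by rewrite /u /block; case: ifP; lia.
rewrite i2 in e2; last first.
- move=> j jr; apply: Vr => i ir; rewrite /u /u' /block; do ![case: ifP]; lia.
- by apply: Vr => i ir; rewrite /u' /block; case: ifP; lia.
- by move=> j jr; apply: Vr => i ir; rewrite /u /u' /block; do ![case: ifP]; lia.
- by rewrite -(V0 (3 * r)%N%:Z); apply: Vr => i ir; rewrite /u /block; case: ifP; lia.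
by exists (t2 - t1); lia.
Qed.

Lemma no_parallel_addition_digits (K : numFieldType) (beta : K) (a : nat) V
    (m n : int) :
  (0 < a)%N -> 1 < beta -> beta ^+ 2 = a%:~R * beta + 1 ->
  m <= 0 <= n -> m < n -> n - m <= a%:Z ->
  ~ converts beta V (digits_in (2 * m) (2 * n)) (digits_in m n).
Proof.
move=> a0 b1 be; wlog n0 : V m n / 0 < n.
  move=> W mn0 mn nma cV; have [n0|n0] := ltP 0 n; first exact: W n0 mn0 mn nma cV.
  apply: (W _ (- n) (- m)); try lia.
  have := converts_opp cV; rewrite (_ : - (2 * n) = 2 * - n); last lia.
  by rewrite (_ : - (2 * m) = 2 * - m); [exact|lia].
move=> mn0 mn nma cV.
have [||s es] := cst_congr (b := n) b1 be cV; try lia.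
have c1 := cst_neq_max (b := n) (e := 2 * n) b1 be cV.
have c2 := cst_neq_min (b := n) (e := 0) b1 be cV.
have cP : m <= V (fun=> n) 0 <= n.
  have [_ /(_ (fun=> n))[|D _]] := cV; last exact: D.
  by move=> j; lia.
have {}c1 : V (fun=> n) 0 <> n by apply: c1; lia.
have {}c2 : V (fun=> n) 0 <> m by apply: c2; lia.
(* [1 <= s] exceeds [n]; [s <= -1] gives at most [n - a <= m], hence exactly [m]. *)
have : s = 0 \/ 1 <= s \/ s <= -1 by lia.
by move=> [s0|[s0|s0]]; [apply: c1; rewrite es s0; lia|nia|nia].
Qed.

(** * Integer words and alphabets *)

Lemma finite_support_finsupp (w : int -> int) :
  finite_set [set j | w j != 0]%classic <-> finsupp w.
Proof.
split=> [/finite_fsetP[X wX]|[N wN]].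
  exists (\sum_(j <- X) (absz j).+1)%N => j jN.
  apply/eqP/negPn/negP => wj.
  have jX : j \in X by have : [set j | w j != 0]%classic j by []; rewrite wX.
  move: jN; rewrite (big_fsetD1 j) //=; lia.
apply: (sub_finite_set (B := [set` [seq k%:Z - N%:Z | k <- iota 0 N.*2]])).
  move=> j /= wj; apply/mapP; exists (absz (j + N%:Z)); last first.
    by have [//|/wN/eqP] := boolP (- N%:Z <= j < N%:Z); [lia|rewrite (negPf wj)].
  rewrite mem_iota; have [//|/wN/eqP] := boolP (- N%:Z <= j < N%:Z); [lia|].
  by rewrite (negPf wj).
exact: finite_seq.
Qed.

Definition int_alphabet (K : nzRingType) (A : {fset K}) (m n : int) : Prop :=
  forall x : K, x \in A <-> exists2 k : int, m <= k <= n & x = k%:~R.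

Lemma int_alphabet_sumset (K : nzRingType) (A : {fset K}) (m n : int) :
  m <= 0 <= n -> int_alphabet A m n -> int_alphabet (sumset A) (2 * m) (2 * n).
Proof.
move=> mn0 Amn x; split=> [/imfset2P/=[y /Amn[k km ->] [z /Amn[l lm ->] ->]]|].
  by exists (k + l); [lia|rewrite intrD].
move=> [k km ->].
(* Clamping [k] to [m .. n] leaves a remainder in [m .. n], because [m <= 0 <= n]. *)
pose i := if k < m then m else if n < k then n else k.
apply/imfset2P; exists i%:~R; last exists (k - i)%:~R.
- by apply/Amn; exists i => //; rewrite /i; do ![case: ifP]; lia.
- by apply/Amn; exists (k - i) => //; rewrite /i; do ![case: ifP]; lia.
- by rewrite -intrD; congr (_%:~R); lia.
Qed.

Definition digit_int (K : nzRingType) (x : K) : int :=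
  xget 0 [set k | x = k%:~R]%classic.

Lemma digit_intK (K : numFieldType) (k : int) : digit_int (k%:~R : K) = k.
Proof. by apply: xget_unique => // l /= /intr_inj ->. Qed.

Definition digit_word (K : nzRingType) (A : {fset K}) (u : int -> A)
    (j : int) : int :=
  digit_int (val (u j)).

Definition word_of (K : nzRingType) (A : {fset K}) (x0 : A) (w : int -> int)
    (j : int) : A := insubd x0 (w j)%:~R.

Lemma digit_int_alphabet (K : numFieldType) (A : {fset K}) (m n : int) (x : A) :
  int_alphabet A m n ->
  val x = (digit_int (val x))%:~R /\ m <= digit_int (val x) <= n.
Proof. by move=> Amn; have /Amn[k kmn ->] := valP x; rewrite digit_intK. Qed.

Lemma digit_word_in (K : numFieldType) (A : {fset K}) (m n : int)
    (u : int -> A) :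
  int_alphabet A m n -> digits_in m n (digit_word u).
Proof. by move=> Amn j; case: (digit_int_alphabet (u j) Amn). Qed.

Lemma finsupp_digit_word (K : numFieldType) (A : {fset K}) (m n : int)
    (u : int -> A) :
  int_alphabet A m n ->
  finitely_many_nonzero u <-> finsupp (digit_word u).
Proof.
move=> Amn; rewrite -finite_support_finsupp /finitely_many_nonzero.
have -> : [set j | val (u j) != 0]%classic =
    [set j | digit_word u j != 0]%classic.
  apply/funext => j /=; rewrite /digit_word.
  have [e _] := digit_int_alphabet (u j) Amn.
  by rewrite {1}e intr_eq0.
by [].
Qed.

Lemma value_digit_word (K : numFieldType) (beta : K) (A : {fset K})
    (m n : int) (u : int -> A) :
  int_alphabet A m n -> value beta u = zval beta (digit_word u).
Proof.
move=> Amn; apply: eq_fsbigr => j _; rewrite /digit_word.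
have [e _] := digit_int_alphabet (u j) Amn.
by rewrite {1}e.
Qed.

Lemma digit_word_of (K : numFieldType) (A : {fset K}) (m n : int)
    (x0 : A) w :
  int_alphabet A m n -> digits_in m n w -> digit_word (word_of x0 w) = w.
Proof.
move=> Amn wmn; apply/funext => j.
rewrite /digit_word /word_of insubdK ?digit_intK //.
by apply/Amn; exists (w j).
Qed.

Lemma allows_parallel_additionP (K : numFieldType) (beta : K) (A : {fset K})
    (m n : int) :
  m <= 0 <= n -> int_alphabet A m n ->
  allows_parallel_addition beta A <->
  exists F, converts beta F (digits_in (2 * m) (2 * n)) (digits_in m n).
Proof.
move=> mn0 Amn; have Smn := int_alphabet_sumset mn0 Amn.
have A0 : 0 \in A by apply/Amn; exists 0.
have S0 : 0 \in sumset A by apply/Smn; exists 0; [lia|].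
split.
  move=> [phi [[_ _ cphi] [p [r [t [pE [Phi PhiE]]]]]]].
  pose s0 : sumset A := [` S0]%fset.
  exists (fun w => digit_word (phi (word_of s0 w))); split.
    exists (r + t)%N => u v i j uv; rewrite /digit_word !PhiE.
    congr (digit_int (val (Phi _))); apply: eq_from_tnth => k.
    rewrite !tnth_mktuple /word_of -!addrA uv //.
    by have := ltn_ord k; lia.
  move=> w wmn; split; first exact: digit_word_in.
  have ew := digit_word_of s0 Smn wmn.
  move=> fw; have [|f1 v1] := cphi (word_of s0 w).
    by apply/(finsupp_digit_word _ Smn); rewrite ew.
  split; first exact/(finsupp_digit_word _ Amn).
  by rewrite -(value_digit_word beta _ Amn) v1 (value_digit_word beta _ Smn) ew.
move=> [F [[r Fr] cF]].
pose a0 : A := [` A0]%fset; pose s0 : sumset A := [` S0]%fset.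
exists (fun u => word_of a0 (F (digit_word u))); split.
  split=> // u fu; have uS := digit_word_in u Smn.
  have [FA /(_ (proj1 (finsupp_digit_word u Smn) fu))[f1 v1]] := cF _ uS.
  have e := digit_word_of a0 Amn FA; split.
    by apply/(finsupp_digit_word _ Amn); rewrite e.
  by rewrite (value_digit_word beta _ Amn) e v1 (value_digit_word beta _ Smn).
exists (r + r + 1)%N, r, r; split=> //.
(* Entry [r - k] of the window holds the letter at [j + k], so the decoded word is recentred at 0.
   Its digits beyond distance [r] are arbitrary, but [F] does not see them at 0. *)
exists (fun s => word_of a0 (F (fun k =>
  digit_int (val (nth s0 s (absz (r%:Z - k)))))) 0) => u j.
rewrite /word_of; congr (insubd a0 _%:~R); apply: Fr => k kr.
have kp : (absz (r%:Z - (0 + k))%R < r + r + 1)%N by lia.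
rewrite -[absz _]/(val (Ordinal kp)) nth_mktuple /digit_word /=.
congr (digit_int (val (u _))); lia.
Qed.

Lemma card_int_alphabet (K : numFieldType) (A : {fset K}) (m n : int) :
  m <= n -> int_alphabet A m n -> (#|` A| = absz (n - m) + 1)%N.
Proof.
move=> mn Amn.
pose s : seq K := [seq (m + k%:Z)%:~R | k <- iota 0 (absz (n - m) + 1)].
have us : uniq s.
  by rewrite map_inj_uniq ?iota_uniq // => k l /intr_inj; lia.
have -> : #|` A| = size s.
  apply/eqP; rewrite -(undup_id us) -card_fseq; apply/eqP.
  congr (#|` _|); apply/fsetP => x; rewrite in_fset /=.
  apply/idP/idP => [/Amn[k km ->]|/mapP[k]].
    apply/mapP; exists (absz (k - m)); first by rewrite mem_iota; lia.
    by congr (_%:~R); lia.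
  by rewrite mem_iota => km ->; apply/Amn; exists (m + k%:Z) => //; lia.
by rewrite size_map size_iota.
Qed.

Theorem theorem39 (R : realType) (a : nat) (beta : R)
    (a_ge1 : (1 <= a)%N) (beta_gt1 : 1 < beta)
    (beta_eq : beta ^+ 2 = a%:R * beta + 1) :
  (forall A : {fset R[i]},
      contiguous_integers A -> 0 \in A -> #|` A| = a.+2 ->
      allows_parallel_addition (beta%:C)%C A) /\
  (forall A : {fset R[i]},
      contiguous_integers A -> 0 \in A -> (exists2 x, x \in A & x != 0) ->
      (#|` A| < a.+2)%N ->
      ~ allows_parallel_addition (beta%:C)%C A).
Proof.
(* The partial order of [R[i]] restricts to the usual one on reals, so the lemmas over a
   [numFieldType] apply to the complex base itself. *)
have b1 : 1 < (beta%:C)%C :> R[i] by rewrite -[1]/(1%:C)%C ltcR.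
have be : (beta%:C)%C ^+ 2 = (a%:Z)%:~R * (beta%:C)%C + 1 :> R[i].
  by rewrite -pmulrn -rmorphXn /= beta_eq rmorphD rmorphM /= rmorph_nat rmorph1.
have alphabet (A : {fset R[i]}) : contiguous_integers A -> 0 \in A ->
    exists m n : int, [/\ m <= 0 <= n, int_alphabet A m n &
      (#|` A| = absz (n - m) + 1)%N].
  move=> [m [n Amn]] /Amn[k kmn /esym/eqP]; rewrite intr_eq0 => /eqP k0.
  by exists m, n; split=> //; [lia|apply: card_int_alphabet => //; lia].
split=> [A /alphabet cA /cA[m [n [mn0 Amn ->]]] cardA|].
  apply/(allows_parallel_additionP (beta%:C)%C mn0 Amn).
  by apply: (parallel_addition_digits be); lia.
move=> A /alphabet cA /cA[m [n [mn0 Amn ->]]] [x /Amn[k kmn ->]].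
rewrite intr_eq0 => k0 cardA /(allows_parallel_additionP (beta%:C)%C mn0 Amn)[V].
by apply: (no_parallel_addition_digits a_ge1 b1 be mn0); lia.
Qed.
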